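(* Let $k\geq 1$ and $1\leq a\leq k$ be integers, and let $$P_{k,a}(x,q)=\sum_{n\geq k}\sum_{\pi\in P_{n,k}}x^nq^{\mathrm{sumelements}_a(\pi)}.$$ Then $$P_{k,a}(x,q)=x^kq^{\frac{a(a-1)}{2}}\left(\prod_{j=1}^{a-1}\frac{1}{1-xq\frac{1-q^j}{1-q}}\right)\left(\prod_{i=a}^{k}\frac{1}{1-ix}\right).$$
   Context: A set partition of $[n]=\{1,\dots,n\}$ with exactly $k$ blocks is a collection $\{B_1,\dots,B_k\}$ of nonempty pairwise disjoint subsets with union $[n]$, the blocks indexed so that $\min B_1<\min B_2<\cdots<\min B_k$. $P_{n,k}$ denotes the set of all such partitions. A partition is identified with its canonical sequential form, the word $\pi=\pi_1\pi_2\cdots\pi_n$ with $i\in B_{\pi_i}$ for all $i$. An entry $\pi_i$ is a record if $\pi_i>\pi_j$ for all $j<i$; in canonical sequential form the records are exactly the first occurrences of the letters $1,2,\dots,k$. For a letter $a\in[k]$, $\mathrm{sumelements}_a(\pi)$ is the sum of all entries $\pi_j$ that precede (i.e. lie at positions strictly before) the record $a$ in $\pi$. For example, for $\pi=121132$, $\mathrm{sumelements}_2(\pi)=1$ and $\mathrm{sumelements}_3(\pi)=1+2+1+1=5$. *)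

(* Defs.v *)
(* MathComp world; classical facts (function extensionality, choice) come from
   mathcomp.classical.boolp. *)
From HB Require Import structures.
From mathcomp Require Import all_boot all_order all_algebra.
From mathcomp Require Import boolp.

Set Implicit Arguments.
Unset Strict Implicit.
Unset Printing Implicit Defensive.

Import GRing.Theory.

(** * Set partitions and canonical sequential form *)

Section SetPartitions.
Local Open Scope nat_scope.

(* [n] = {1, ..., n} is represented by 'I_n = {0, ..., n-1}: the element i of
   [n] is the ordinal of value i - 1.  [partition] forbids the empty block. *)
Definition set_partitions (n k : nat) : {set {set {set 'I_n}}} :=
  [set P : {set {set 'I_n}} | partition P [set: 'I_n] & #|P| == k].

(* The default value n is only returned on the empty set. *)
Definition block_min (n : nat) (B : {set 'I_n}) : nat :=
  \big[minn/n]_(i in B) i.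

Definition blocks (n : nat) (P : {set {set 'I_n}}) : seq {set 'I_n} :=
  sort (fun B C => block_min B <= block_min C) (enum P).

(* Blocks, hence letters, are numbered from 1. *)
Definition letter (n : nat) (P : {set {set 'I_n}}) (i : 'I_n) : nat :=
  (index (pblock P i) (blocks P)).+1.

Definition canonical_word (n : nat) (P : {set {set 'I_n}}) : seq nat :=
  [seq letter P i | i <- enum 'I_n].

Definition is_record (w : seq nat) (i : nat) : bool :=
  all (fun b => b < nth 0 w i) (take i w).

(* Records being strict, a word has at most one record equal to a; when there
   is none the value is [size w]. *)
Definition record_pos (a : nat) (w : seq nat) : nat :=
  find (fun i => is_record w i && (nth 0 w i == a)) (iota 0 (size w)).

Definition sumelements (a : nat) (w : seq nat) : nat :=
  sumn (take (record_pos a w) w).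

End SetPartitions.

(** * Formal power series in one variable *)

Local Open Scope ring_scope.

(* [Fps c] is the series \sum_n c n x^n.  The record keeps the Cauchy product
   apart from any pointwise structure on functions nat -> R. *)
Record fps (R : Type) := Fps { fcoef : nat -> R }.

Lemma fpsP (R : Type) (f g : fps R) : fcoef f =1 fcoef g <-> f = g.
Proof.
split=> [|-> //]; case: f g => [f] [g] /= fg.
by congr Fps; apply/funext.
Qed.

HB.instance Definition _ (R : Type) := gen_eqMixin (fps R).
HB.instance Definition _ (R : Type) := gen_choiceMixin (fps R).

Section FpsZmod.
Variable R : zmodType.

Definition fps_zero : fps R := Fps (fun=> 0).
Definition fps_opp (f : fps R) : fps R := Fps (fun n => - fcoef f n).
Definition fps_add (f g : fps R) : fps R :=
  Fps (fun n => fcoef f n + fcoef g n).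

Fact fps_addA : associative fps_add.
Proof. by move=> f g h; apply/fpsP => n /=; rewrite addrA. Qed.
Fact fps_addC : commutative fps_add.
Proof. by move=> f g; apply/fpsP => n /=; rewrite addrC. Qed.
Fact fps_add0 : left_id fps_zero fps_add.
Proof. by move=> f; apply/fpsP => n /=; rewrite add0r. Qed.
Fact fps_addN : left_inverse fps_zero fps_opp fps_add.
Proof. by move=> f; apply/fpsP => n /=; rewrite addNr. Qed.

HB.instance Definition _ :=
  GRing.isZmodule.Build (fps R) fps_addA fps_addC fps_add0 fps_addN.
End FpsZmod.

Definition fpsC (R : nmodType) (c : R) : fps R :=
  Fps (fun n => if n == 0%N then c else 0).

Section FpsRing.
Variable R : comNzRingType.
Implicit Types f g h : fps R.

Definition fpsX : fps R := Fps (fun n => (n == 1%N)%:R).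

Definition fps_mul f g : fps R :=
  Fps (fun n => \sum_(i < n.+1) fcoef f i * fcoef g (n - i)).

Definition fps_trunc (m : nat) f : {poly R} := \poly_(i < m) fcoef f i.

Fact fps_mul_trunc m n f g : (n < m)%N ->
  fcoef (fps_mul f g) n = (fps_trunc m f * fps_trunc m g)`_n.
Proof.
move=> nm; rewrite coefM /=; apply: eq_bigr => i _; rewrite !coef_poly.
have le_in : (i <= n)%N by rewrite -ltnS.
by rewrite (leq_ltn_trans le_in nm) (leq_ltn_trans (leq_subr i n) nm).
Qed.

Fact fps_mulA : associative fps_mul.
Proof.
move=> f g h; apply/fpsP => n; set m := n.+1.
have mulE f' g' i : (i < m)%N ->
    (fps_trunc m (fps_mul f' g'))`_i = (fps_trunc m f' * fps_trunc m g')`_i.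
  by move=> im; rewrite coef_poly im (fps_mul_trunc _ _ im).
rewrite !(@fps_mul_trunc m) //.
transitivity ((fps_trunc m f * (fps_trunc m g * fps_trunc m h))`_n).
  rewrite !coefM; apply: eq_bigr => i _.
  by rewrite mulE // /m ltnS leq_subr.
rewrite mulrA [LHS]coefM [RHS]coefM; apply: eq_bigr => i _.
by rewrite mulE.
Qed.

Fact fps_mulC : commutative fps_mul.
Proof.
by move=> f g; apply/fpsP => n; rewrite !(@fps_mul_trunc n.+1) // mulrC.
Qed.

Fact fps_mul1 : left_id (fpsC 1) fps_mul.
Proof.
move=> f; apply/fpsP => n /=; rewrite big_ord_recl /= mul1r subn0.
by rewrite big1 ?addr0 // => i _; rewrite mul0r.
Qed.

Fact fps_mulDl : left_distributive fps_mul +%R.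
Proof.
move=> f g h; apply/fpsP => n /=; rewrite -big_split /=.
by apply: eq_bigr => i _; rewrite mulrDl.
Qed.

Fact fps_oner_neq0 : fpsC 1 != 0 :> fps R.
Proof. by apply/eqP => /fpsP/(_ 0%N)/eqP; rewrite /= oner_eq0. Qed.

HB.instance Definition _ := GRing.Zmodule_isComNzRing.Build (fps R)
  fps_mulA fps_mulC fps_mul1 fps_mulDl fps_oner_neq0.
End FpsRing.

Arguments fpsX {R}.

Section FpsUnit.
Variable R : comUnitRingType.
Implicit Types f g : fps R.

Definition fps_unit : pred (fps R) := fun f => fcoef f 0 \is a GRing.unit.

(* The coefficients 0, ..., n of the inverse g of f, from the recursion
   g_0 = f_0^-1, g_(n+1) = - f_0^-1 \sum_(i <= n) g_i f_(n+1-i). *)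
Fixpoint fps_inv_coefs f (n : nat) : seq R :=
  if n is n'.+1 then
    let s := fps_inv_coefs f n' in
    rcons s (- ((fcoef f 0)^-1 * \sum_(i < n) s`_i * fcoef f (n - i)))
  else [:: (fcoef f 0)^-1].

Definition fps_inv f : fps R :=
  if fps_unit f then Fps (fun n => (fps_inv_coefs f n)`_n) else f.

Fact size_fps_inv_coefs f n : size (fps_inv_coefs f n) = n.+1.
Proof. by elim: n => //= n IHn; rewrite size_rcons IHn. Qed.

Fact nth_fps_inv_coefs f n i : (i <= n)%N ->
  (fps_inv_coefs f n)`_i = (fps_inv_coefs f i)`_i.
Proof.
elim: n => [|n IHn]; first by rewrite leqn0 => /eqP ->.
rewrite leq_eqVlt => /predU1P[-> // | ]; rewrite ltnS => le_in.
by rewrite /= nth_rcons size_fps_inv_coefs ltnS le_in IHn.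
Qed.

Fact fps_mulVr : {in fps_unit, left_inverse 1 fps_inv *%R}.
Proof.
move=> f Uf; rewrite /fps_inv (_ : fps_unit f); last exact: Uf.
apply/fpsP => -[|n]; first by rewrite /= big_ord1 /= mulVr.
rewrite [LHS]/= big_ord_recr /= subnn nth_rcons size_fps_inv_coefs ltnn eqxx.
rewrite mulNr mulrAC mulVr ?mul1r //; apply/eqP; rewrite subr_eq0; apply/eqP.
by apply: eq_bigr => i _; rewrite (@nth_fps_inv_coefs f n) // -ltnS.
Qed.

Fact fps_unitPl f g : g * f = 1 -> fps_unit f.
Proof.
move=> /fpsP/(_ 0%N); rewrite /= big_ord1 subnn => gf1.
by apply/unitrP; exists (fcoef g 0); split; last rewrite mulrC.
Qed.

Fact fps_inv_out : {in [predC fps_unit], fps_inv =1 id}.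
Proof.
by move=> f nUf; rewrite /fps_inv; case: ifP => // Uf; case/negP: nUf.
Qed.

HB.instance Definition _ := GRing.ComNzRing_hasMulInverse.Build (fps R)
  fps_mulVr fps_unitPl fps_inv_out.
End FpsUnit.

(** * The generating function *)

(* The coefficients live in the field Q(q), so that (1 - q^j) / (1 - q) is a
   genuine quotient; series are in the ring Q(q)[[x]]. *)
Definition Qq : fieldType := {fraction {poly rat}}.

Definition q : Qq := tofrac 'X.

Definition P_gf (k a : nat) : fps Qq :=
  Fps (fun n => if (k <= n)%N
                then \sum_(P in set_partitions n k)
                       q ^+ sumelements a (canonical_word P)
                else 0).

(* Main.v *)
(* Canonical sequential forms are the restricted growth functions: words in
   which every new letter is one more than the current maximum.  Deleting the
   last entry of such a word with k letters leaves either a word with k letters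
   (and the last entry was any of 1, ..., k) or one with k - 1 letters (and the
   last entry was the record k).  Before the record a the deleted entry c has
   weight q^c, after it weight 1, so each new record k contributes a factor
   x q^k / (1 - x (q + ... + q^k)) for k < a, x / (1 - k x) for k >= a. *)
Require Import Defs.
From HB Require Import structures.
From mathcomp Require Import all_boot all_order all_algebra.

Import GRing.Theory.
Local Open Scope ring_scope.

(** * Restricted growth functions *)

Section RestrictedGrowth.
Local Open Scope nat_scope.

Lemma takel_rcons (T : Type) i (s : seq T) x :
  i <= size s -> take i (rcons s x) = take i s.
Proof. by move=> le_i; rewrite -cats1 takel_cat. Qed.

(** Growth is phrased by earlier occurrences rather than by a running maximum: this form passes
    directly to prefixes and can be read off a partition block by block. *)
Definition rgf (w : seq nat) : Prop :=
  0 \notin w /\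
  forall i b, i < size w -> 0 < b < nth 0 w i -> b \in take i w.

Lemma rgf_rcons w c :
  rgf (rcons w c) <->
    [/\ rgf w, 0 < c & forall b, 0 < b < c -> b \in w].
Proof.
rewrite /rgf mem_rcons inE negb_or eq_sym -lt0n size_rcons.
split=> [[/andP[c_gt0 w_gt0] grow] | [[w_gt0 grow] c_gt0 growc]].
  split=> // [|b bc]; last first.
    have:= grow (size w) b; rewrite nth_rcons ltnn eqxx takel_rcons //.
    by rewrite take_size; apply.
  split=> // i b iw; have:= grow i b.
  by rewrite nth_rcons iw takel_rcons ?(ltnW iw) //; apply=> //; apply: leqW.
split; first by rewrite c_gt0.
move=> i b; rewrite ltnS leq_eqVlt nth_rcons => /predU1P[-> | iw].
  by rewrite ltnn eqxx takel_rcons // take_size; apply: growc.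
by rewrite iw takel_rcons ?(ltnW iw) //; apply: grow.
Qed.

Fixpoint rgfs (n k : nat) : seq (seq nat) :=
  match n, k with
  | 0, 0 => [:: [::]]
  | 0, _.+1 => [::]
  | n'.+1, 0 => [::]
  | n'.+1, k'.+1 =>
      [seq rcons w c | w <- rgfs n' k, c <- iota 1 k] ++
      [seq rcons w k | w <- rgfs n' k']
  end.

Lemma rgfsS n k :
  rgfs n.+1 k.+1 =
    [seq rcons w c | w <- rgfs n k.+1, c <- iota 1 k.+1] ++
    [seq rcons w k.+1 | w <- rgfs n k].
Proof. by []. Qed.

Lemma rgfs_lt n k : n < k -> rgfs n k = [::].
Proof.
by elim: n k => [|n IHn] [|k] //=; rewrite ltnS => nk; rewrite !IHn // ltnW.
Qed.

Lemma mem_rgfs n k w :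
  w \in rgfs n k <->
    [/\ size w = n, rgf w & forall b, (b \in w) = (0 < b <= k)].
Proof.
elim: n k w => [|n IHn] k w.
  case: k => [|k]; rewrite ?inE ?in_nil; split=> //.
  - by move/eqP->; split=> // -[].
  - by case=> /size0nil ->.
  - by case=> /size0nil-> _ /(_ 1).
case/lastP: w => [|w c].
  split=> [|[]//]; case: k => // k.
  by rewrite rgfsS mem_cat => /orP[/allpairsP[[[|? ?] ?] []]|/mapP[[|? ?]]].
have size_w : size (rcons w c) = n.+1 <-> size w = n.
  by rewrite size_rcons; split=> [[]|->].
split.
  case: k => // k; rewrite rgfsS mem_cat => /orP[/allpairsP|/mapP].
    case=> [[v d] [/IHn[sv rv kv]]].
    rewrite mem_iota add1n ltnS => /andP[/= d0 dk].
    case/rcons_inj=> -> ->; split; rewrite ?size_rcons ?sv //.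
      apply/rgf_rcons; split=> // b /andP[b0 /ltnW bd].
      by rewrite kv b0 (leq_trans bd).
    by move=> b; rewrite mem_rcons inE kv; case: eqP => //= ->; rewrite d0.
  case=> v /IHn[sv rv kv] /rcons_inj[-> ->]; split; rewrite ?size_rcons ?sv //.
    by apply/rgf_rcons; split=> // b; rewrite kv.
  move=> b; rewrite mem_rcons inE kv (leq_eqVlt b k.+1) ltnS.
  by case: eqP => //= ->.
case=> /size_w sw /rgf_rcons[rw c0 growc] kw.
have ck : c <= k by have := kw c; rewrite mem_rcons mem_head c0 => /esym.
case: k ck kw => [|k] ck kw; first by rewrite leqNgt c0 in ck.
rewrite rgfsS mem_cat; apply/orP.
(* An old last letter leaves the alphabet of [w] unchanged; a new one must be the largest. *)
have [cw | cNw] := boolP (c \in w); [left|right].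
  apply/allpairsP; exists (w, c); split=> //.
    apply/IHn; split=> // b; rewrite -kw mem_rcons inE.
    by case: eqP => // ->.
  by rewrite mem_iota add1n ltnS c0.
(* Were [c] smaller, [k.+1] would occur in [w], and growth would force [c] to occur before it. *)
have ck1 : c = k.+1.
  apply/eqP; rewrite eqn_leq ck leqNgt; apply/negP => ltck.
  have := kw k.+1; rewrite mem_rcons inE leqnn gtn_eqF //=.
  case/(nthP 0) => i iw wi.
  case/negP: cNw; apply: (@mem_take i); case: rw => _; apply=> //.
  by rewrite wi c0.
apply/mapP; exists w; last by rewrite ck1.
apply/IHn; split=> // b; have := kw b; rewrite mem_rcons inE.
case: (b =P c) => [-> _ | /eqP bc /= ->].
  by rewrite (negbTE cNw) ck1 ltnn.
by rewrite (leq_eqVlt b k.+1) -ck1 (negbTE bc) /= ck1 ltnS.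
Qed.

Lemma uniq_rgfs n k : uniq (rgfs n k).
Proof.
elim: n k => [|n IHn] [|k] //.
rewrite rgfsS cat_uniq map_inj_uniq ?IHn ?andbT; last first.
  by move=> v w /rcons_inj[].
apply/andP; split.
  apply: allpairs_uniq; rewrite ?IHn ?iota_uniq //.
  by move=> [v c] [w d] _ _ /rcons_inj[-> ->].
(* The two lists are disjoint: a common word would have a prefix that both contains and omits
   [k.+1]. *)
apply/hasPn => _ /mapP[w /mem_rgfs[_ _ kw] ->].
apply/negP => /allpairsP[[v d] /= [/mem_rgfs[_ _ kv] _ /rcons_inj[ewv _]]].
by have := kv k.+1; rewrite -ewv kw ltnn andbF leqnn.
Qed.

(* Each entry of a restricted growth function is either repeated from the past
   or the smallest letter not yet used, so the level sets determine it. *)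
Lemma rgf_inj v w : rgf v -> rgf w -> size v = size w ->
  (forall i j, i < size w -> j < size w ->
     (nth 0 v i == nth 0 v j) = (nth 0 w i == nth 0 w j)) ->
  v = w.
Proof.
move=> [v0 growv] [w0 groww] svw levels; apply: (@eq_from_nth _ 0) => // i.
rewrite svw; elim/ltn_ind: i => i IHi iw.
have take_vw : take i v = take i w.
  apply: (@eq_from_nth _ 0) => [|j]; rewrite !size_take svw // iw => ji.
  by rewrite !nth_take // IHi // (ltn_trans ji).
have pos u : 0 \notin u -> size u = size w -> 0 < nth 0 u i.
  move=> u0 su; rewrite lt0n; apply: contraNneq u0 => <-.
  by rewrite mem_nth ?su.
have old u : size u = size w -> nth 0 u i \in take i u ->
    exists2 j, j < i & nth 0 u j = nth 0 u i.
  move=> su /(nthP 0)[j]; rewrite size_take su iw => ji.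
  by rewrite nth_take // => ej; exists j.
(* If the entries differ, growth puts the smaller one in the common prefix, at some [j]; equality of
   levels then makes the larger one equal to the entry at [j] as well. *)
case: (ltngtP (nth 0 v i) (nth 0 w i)) => // lt.
- have: nth 0 v i \in take i v.
    by rewrite take_vw groww // pos.
  case/old=> // j ji ej; have jw := ltn_trans ji iw.
  by rewrite -ej IHi //; apply/eqP; rewrite -levels // ej.
- have: nth 0 w i \in take i w.
    by rewrite -take_vw growv ?svw // pos.
  case/old=> // j ji ej; have jw := ltn_trans ji iw.
  by rewrite -ej -IHi //; apply/eqP; rewrite levels // ej.
Qed.

(** The first [a] is a record: a larger entry before it would, by growth, be preceded by a still
    earlier [a]. If [a] is absent, both sides are the size of [w]. *)
Lemma record_posE a w : rgf w -> record_pos a w = index a w.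
Proof.
case=> w0 grow; rewrite /record_pos.
have [aw | aNw] := boolP (a \in w); last first.
  rewrite memNindex // hasNfind ?size_iota //; apply/hasPn => i.
  rewrite mem_iota add0n /= => iw; apply: contra aNw => /andP[_ /eqP <-].
  exact: mem_nth.
have jw : index a w < size w by rewrite index_mem.
rewrite -(subnKC jw) addSnnS iotaD find_cat size_iota add0n /= nth_index //.
rewrite eqxx andbT ifN.
  rewrite ifT ?addn0 //; apply/allP => b bj; rewrite nth_index // ltnNge.
  have aNj : a \notin take (index a w) w by rewrite in_take // ltnn.
  apply: contra aNj; rewrite leq_eqVlt => /predU1P[eab | ab].
    by rewrite {1}eab.
  have /(nthP 0)[i] := bj; rewrite size_take jw => ij.
  rewrite nth_take // => wi.
  have a_gt0 : 0 < a by rewrite lt0n; apply: contraNneq w0 => <-.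
  have := grow i a (ltn_trans ij jw); rewrite wi a_gt0 ab => /(_ isT).
  by rewrite !in_take // ltnn => /ltn_trans/(_ ij); rewrite ltnn.
apply/hasPn => i; rewrite mem_iota add0n /= => ij.
by apply/nandP; right; rewrite -[_ == a]/(pred1 a _) before_find.
Qed.

End RestrictedGrowth.

(** * Canonical words of partitions are the restricted growth functions *)

Section CanonicalWord.
Local Open Scope nat_scope.

Lemma block_minE (n : nat) (B : {set 'I_n}) (i : 'I_n) :
  i \in B -> {m | m \in B & block_min B = m}.
Proof.
move=> iB; rewrite /block_min -[minn]minEnat.
(* The default [n] bounds every element, so the minimum over a nonempty block is attained. *)
have le_n (j : 'I_n) : j \in B -> ((j : nat) <= n)%O by move=> _; apply: ltnW.
have [m mB minB] := Order.TotalTheory.eq_bigmin i _ (@nat_of_ord n) iB le_n.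
by exists m.
Qed.

Lemma block_min_le (n : nat) (B : {set 'I_n}) (i : 'I_n) :
  i \in B -> block_min B <= i.
Proof.
move=> iB; rewrite /block_min -[minn]minEnat.
exact: (Order.TotalTheory.bigmin_le_cond n (@nat_of_ord n) iB).
Qed.

Lemma nth_canonical_word (n : nat) (P : {set {set 'I_n}}) (i : 'I_n) :
  nth 0 (canonical_word P) i = letter P i.
Proof. by rewrite (nth_map i) ?size_enum_ord // nth_ord_enum. Qed.

Lemma size_canonical_word (n : nat) (P : {set {set 'I_n}}) :
  size (canonical_word P) = n.
Proof. by rewrite size_map size_enum_ord. Qed.

Variables (n : nat) (P : {set {set 'I_n}}).
Hypothesis partP : partition P [set: 'I_n].

Let tiP : trivIset P. Proof. by case/and3P: partP. Qed.
Let coverP i : i \in cover P.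
Proof. by rewrite (cover_partition partP) inE. Qed.

Lemma mem_blocks B : (B \in blocks P) = (B \in P).
Proof. by rewrite mem_sort mem_enum. Qed.

Lemma size_blocks : size (blocks P) = #|P|.
Proof. by rewrite size_sort -cardE. Qed.

Lemma letter_eq i j : (letter P i == letter P j) = (pblock P i == pblock P j).
Proof.
rewrite eqSS; apply/eqP/eqP => [eq_ij | -> //].
by apply: (index_inj set0 _ _ eq_ij); rewrite mem_blocks pblock_mem.
Qed.

Lemma letter_bounds i : 0 < letter P i <= #|P|.
Proof. by rewrite -size_blocks index_mem mem_blocks pblock_mem. Qed.

(** The witness is the minimum of the [b]-th block; since blocks are sorted by minima, no element of
    this or a later block precedes it. *)
Lemma exists_first_letter b : 0 < b <= #|P| ->
  exists2 m, letter P m = b & forall i, b <= letter P i -> m <= i.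
Proof.
case: b => // b /=; rewrite -size_blocks => b_lt.
set B := nth set0 (blocks P) b.
have BP : B \in P by rewrite -mem_blocks mem_nth.
have [i0 i0B] : exists i, i \in B.
  apply/set0Pn; apply: contraTneq BP => ->.
  by case/and3P: partP.
have [m mB minB] := block_minE _ _ _ i0B.
exists m.
  rewrite /letter (def_pblock tiP BP mB) index_uniq //.
  by rewrite sort_uniq enum_uniq.
move=> i; rewrite ltnS => le_bi; rewrite -minB.
have iP : pblock P i \in blocks P by rewrite mem_blocks pblock_mem.
apply: leq_trans (block_min_le _ _ _ (_ : i \in pblock P i)); last first.
  by rewrite mem_pblock.
rewrite -[pblock P i](nth_index set0 iP).
pose leB (C D : {set 'I_n}) := block_min C <= block_min D.
apply: (@sorted_leq_nth _ leB _ _ set0 (blocks P)) => //.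
- by move=> C D E; apply: leq_trans.
- by move=> C; apply: leqnn.
- by apply: sort_sorted => C D; apply: leq_total.
- by rewrite inE index_mem.
Qed.

Lemma mem_canonical_word b : (b \in canonical_word P) = (0 < b <= #|P|).
Proof.
apply/mapP/idP => [[i _ ->] | /exists_first_letter[m <- _]].
  exact: letter_bounds.
by exists m; rewrite ?mem_enum.
Qed.

Lemma rgf_canonical_word : rgf (canonical_word P).
Proof.
split=> [|i b]; first by rewrite mem_canonical_word.
rewrite size_canonical_word => lt_in; pose i' := Ordinal lt_in.
rewrite -[i]/(i' : nat) nth_canonical_word => /andP[b0 bi].
have /exists_first_letter[m mb min_m] : 0 < b <= #|P|.
  rewrite b0; apply: leq_trans (ltnW bi) _.
  by case/andP: (letter_bounds i').
(* The inequality is strict because positions [m] and [i'] carry different letters. *)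
have lt_mi : m < i'.
  rewrite ltn_neqAle min_m ?(ltnW bi) // andbT.
  by apply: contraTneq bi => /val_inj <-; rewrite mb ltnn.
apply/(nthP 0); exists m; last by rewrite nth_take // nth_canonical_word.
by rewrite size_take size_canonical_word lt_in.
Qed.

End CanonicalWord.

(** Equal letters mean equal blocks, so the word determines the equivalence relation and thus the
    partition. *)
Lemma canonical_word_inj n k :
  {in set_partitions n k &, injective (@canonical_word n)}.
Proof.
move=> P Q; rewrite !inE => /andP[pP _] /andP[pQ _] ePQ.
rewrite -(preim_partition_pblock pP) -(preim_partition_pblock pQ).
apply: eq_imset => i; apply/setP => j; rewrite !inE.
by rewrite -!letter_eq // -!nth_canonical_word ePQ.
Qed.

(** The level sets of [w] form a partition whose canonical word has the same level sets, so
    [rgf_inj] identifies the two words. *)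
Lemma canonical_word_surj w : rgf w ->
  exists2 P : {set {set 'I_(size w)}},
    partition P [set: _] & canonical_word P = w.
Proof.
move=> rw; set n := size w.
pose P := preim_partition (fun i : 'I_n => nth 0%N w i) [set: 'I_n].
have pP : partition P [set: 'I_n] by apply: preim_partitionP.
exists P => //; apply: rgf_inj; rewrite ?size_canonical_word //.
  exact: rgf_canonical_word.
move=> i j i_lt j_lt; pose i' := Ordinal i_lt; pose j' := Ordinal j_lt.
rewrite -[i]/(i' : nat) -[j]/(j' : nat) !nth_canonical_word letter_eq //.
have [/eqP covP tiP _] := and3P pP.
rewrite eq_pblock ?covP // pblock_equivalence_partition ?inE //.
by split=> // /eqP->.
Qed.

Lemma big_set_partitions (V : nmodType) (F : seq nat -> V) n k :
  \sum_(P in set_partitions n k) F (canonical_word P) =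
  \sum_(w <- rgfs n k) F w.
Proof.
rewrite -big_enum -(big_map (@canonical_word n) xpredT F) /=.
apply: perm_big; apply: uniq_perm; last first.
- move=> w; apply/mapP/idP => [[P] | /mem_rgfs[<- rw kw]].
    rewrite mem_enum inE => /andP[pP /eqP cP] ->; apply/mem_rgfs; split.
    + by rewrite size_canonical_word.
    + exact: rgf_canonical_word.
    + by move=> b; rewrite mem_canonical_word // cP.
  have [P pP eP] := canonical_word_surj w rw; exists P => //.
  rewrite mem_enum inE pP; apply/eqP.
  (* Both intervals are the alphabet of [w]; comparing their upper ends gives the number of
     blocks. *)
  have cardE b : (0 < b <= #|P|)%N = (0 < b <= k)%N.
    by rewrite -mem_canonical_word // eP kw.
  have:= cardE #|P|; have:= cardE k; rewrite !leqnn !andbT.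
  case: k {kw cardE} => [|k]; case: #|P| => [|p] //= kp pk.
  by apply/eqP; rewrite eqn_leq -pk kp.
- exact: uniq_rgfs.
rewrite map_inj_in_uniq ?enum_uniq // => P Q.
by rewrite !mem_enum; apply: canonical_word_inj.
Qed.

(** * The statistic under appending a letter *)

Section SumElements.
Local Open Scope nat_scope.

Lemma sumelementsE a w : rgf w -> sumelements a w = sumn (take (index a w) w).
Proof. by move=> rw; rewrite /sumelements record_posE. Qed.

Lemma rgfs_rcons n k w c : w \in rgfs n k -> 0 < c <= k.+1 -> rgf (rcons w c).
Proof.
move=> /mem_rgfs[_ rw kw] /andP[c0 ck]; apply/rgf_rcons; split=> // b.
by case/andP=> b0 bc; rewrite kw b0 -ltnS (leq_trans bc).
Qed.

Lemma sumelements_rcons_old n k a w c : w \in rgfs n k -> 0 < c <= k.+1 ->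
  0 < a <= k -> sumelements a (rcons w c) = sumelements a w.
Proof.
move=> wk ck ak; have [_ rw kw] := iffLR (mem_rgfs _ _ _) wk.
rewrite !sumelementsE //; last exact: rgfs_rcons wk ck.
by rewrite -cats1 index_cat kw ak takel_cat // ltnW // index_mem kw.
Qed.

Lemma sumelements_rcons_new n k w : w \in rgfs n k ->
  sumelements k.+1 (rcons w k.+1) = sumn w.
Proof.
move=> wk; have [_ rw kw] := iffLR (mem_rgfs _ _ _) wk.
rewrite sumelementsE; last by apply: rgfs_rcons wk _; rewrite leqnn.
by rewrite -cats1 index_cat kw ltnn /= eqxx addn0 take_size_cat.
Qed.

End SumElements.

(** * Generating functions and their recurrences *)

Section Series.
Variable R : comUnitRingType.
Implicit Types f g : fps R.

Lemma fcoef0_mulX f : fcoef (fpsX * f) 0 = 0.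
Proof. by rewrite /= big_ord1 /= mul0r. Qed.

Lemma fcoefS_mulX f n : fcoef (fpsX * f) n.+1 = fcoef f n.
Proof.
rewrite /= big_ord_recl mul0r add0r big_ord_recl /= mul1r subSS subn0.
by rewrite big1 ?addr0 // => i _; rewrite mul0r.
Qed.

Lemma fcoef_mulC c f n : fcoef (fpsC c * f) n = c * fcoef f n.
Proof.
rewrite /= big_ord_recl /= subn0 big1 ?addr0 // => i _.
by rewrite mul0r.
Qed.

Lemma fpsC_nat m : m%:R = fpsC m%:R :> fps R.
Proof.
elim: m => [|m IHm]; first by apply/fpsP => -[].
by rewrite !mulrS IHm; apply/fpsP => -[|n] /=; rewrite ?addr0.
Qed.

Lemma fpsCM c d : fpsC (c * d) = fpsC c * fpsC d :> fps R.
Proof.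
by apply/fpsP => n; rewrite fcoef_mulC /=; case: eqP; rewrite ?mulr0.
Qed.

(** The hypotheses say [f = x (c f + g)] coefficientwise; [1 - c x] has constant term 1 and can be
    inverted. *)
Lemma fps_recurrence c f g : fcoef f 0 = 0 ->
    (forall n, fcoef f n.+1 = c * fcoef f n + fcoef g n) ->
  f = fpsX * g * (1 / (1 - fpsX * fpsC c)).
Proof.
move=> f0 fS; have U : 1 - fpsX * fpsC c \is a GRing.unit.
  by rewrite unfold_in /= /fps_unit /= big_ord1 /= mul0r subr0 unitr1.
rewrite mul1r; apply: (canRL (mulrK U)).
rewrite mulrBr mulr1 mulrCA [f * _]mulrC.
have fcoefB h k m : fcoef (h - k : fps R) m = fcoef h m - fcoef k m by [].
apply/fpsP => -[|n]; first by rewrite fcoefB !fcoef0_mulX f0 subr0.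
by rewrite fcoefB !fcoefS_mulX fS fcoef_mulC addrAC subrr add0r.
Qed.

Definition rgf_gf (t : R) (stat : seq nat -> nat) (k : nat) : fps R :=
  Fps (fun n => \sum_(w <- rgfs n k) t ^+ stat w).

Lemma rgf_gfS0 t stat k : fcoef (rgf_gf t stat k.+1) 0 = 0.
Proof. by rewrite /= big_nil. Qed.

Lemma fcoef_rgf_gfS t stat k n :
  fcoef (rgf_gf t stat k.+1) n.+1 =
    \sum_(w <- rgfs n k.+1) \sum_(1 <= c < k.+2) t ^+ stat (rcons w c) +
    \sum_(w <- rgfs n k) t ^+ stat (rcons w k.+1).
Proof.
rewrite [LHS]/fcoef /rgf_gf rgfsS big_cat big_map; congr (_ + _).
by rewrite (big_allpairs_dep (h := fun w c => rcons w c)).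
Qed.

Lemma sumn_gfS t k :
  rgf_gf t sumn k.+1 =
    fpsX * (fpsC (t ^+ k.+1) * rgf_gf t sumn k) *
      (1 / (1 - fpsX * fpsC (\sum_(1 <= c < k.+2) t ^+ c))).
Proof.
apply: fps_recurrence => [|n]; first exact: rgf_gfS0.
rewrite fcoef_rgf_gfS fcoef_mulC; congr (_ + _).
  rewrite /= big_distrr /=; apply: eq_bigr => w _; rewrite big_distrl /=.
  by apply: eq_bigr => c _; rewrite sumn_rcons exprD mulrC.
rewrite /= big_distrr; apply: eq_bigr => w _.
by rewrite sumn_rcons exprD mulrC.
Qed.

Lemma sum_sumelements_old (t : R) n k a : (0 < a <= k)%N ->
  \sum_(w <- rgfs n k) \sum_(1 <= c < k.+1) t ^+ sumelements a (rcons w c) =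
    k%:R * \sum_(w <- rgfs n k) t ^+ sumelements a w.
Proof.
move=> ak; rewrite big_distrr; apply: eq_big_seq => w wk /=.
rewrite mulr_natl -[in RHS](subn0 k) -subSS -sumr_const_nat.
apply: eq_big_nat => c /andP[c0 ck].
by rewrite (sumelements_rcons_old _ _ _ _ _ wk) // c0 ltnW.
Qed.

(** Here the statistic changes: when the record [a.+1] is appended, the whole word before it counts,
    so [sumn] takes over on the right. *)
Lemma sumelements_gf_first t a :
  rgf_gf t (sumelements a.+1) a.+1 =
    fpsX * rgf_gf t sumn a * (1 / (1 - a.+1%:R * fpsX)).
Proof.
rewrite [_%:R * fpsX]mulrC fpsC_nat.
apply: fps_recurrence => [|n]; first exact: rgf_gfS0.
rewrite fcoef_rgf_gfS sum_sumelements_old ?leqnn //; congr (_ + _).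
by apply: eq_big_seq => w wk; rewrite (sumelements_rcons_new _ _ _ wk).
Qed.

Lemma sumelements_gfS t a k : (0 < a <= k)%N ->
  rgf_gf t (sumelements a) k.+1 =
    fpsX * rgf_gf t (sumelements a) k * (1 / (1 - k.+1%:R * fpsX)).
Proof.
move=> ak; rewrite [_%:R * fpsX]mulrC fpsC_nat.
apply: fps_recurrence => [|n]; first exact: rgf_gfS0.
have [a0 le_ak] := andP ak.
rewrite fcoef_rgf_gfS sum_sumelements_old ?a0 1?leqW //; congr (_ + _).
apply: eq_big_seq => w wk.
by rewrite (sumelements_rcons_old _ _ _ _ _ wk) // leqnn.
Qed.

Lemma sumn_gf t k :
  rgf_gf t sumn k =
    fpsX ^+ k * fpsC (t ^+ (k.+1 * k %/ 2)) *
    \prod_(1 <= j < k.+1)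
      (1 / (1 - fpsX * fpsC (\sum_(1 <= c < j.+1) t ^+ c))).
Proof.
elim: k => [|k IHk].
  rewrite big_geq // !mulr1; apply/fpsP => -[|n]; rewrite /= ?big_nil //.
  by rewrite big_seq1.
(* The records contribute their sum, a triangular number. *)
have e : ((k.+2 * k.+1) %/ 2 = k.+1 + (k.+1 * k) %/ 2)%N.
  by rewrite -addn2 mulnDl mulnC addnC mulnC divnMDl // mulnC.
rewrite sumn_gfS IHk [in RHS]big_nat_recr //= e exprD fpsCM.
rewrite [fpsX ^+ k.+1]exprS !mulrA.
by rewrite (mulrAC fpsX).
Qed.

Lemma sumelements_gf t k a : (0 < a <= k)%N ->
  rgf_gf t (sumelements a) k =
    fpsX ^+ k * fpsC (t ^+ (a * (a - 1) %/ 2)) *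
    (\prod_(1 <= j < a)
       (1 / (1 - fpsX * fpsC (\sum_(1 <= c < j.+1) t ^+ c)))) *
    (\prod_(a <= i < k.+1) (1 / (1 - i%:R * fpsX))).
Proof.
case: a => // a /=; elim: k => // k IHk; rewrite leq_eqVlt eqSS.
(* The induction on the number of letters starts where the record [a.+1] is the last one; each
   further record adds one factor of the second product. *)
case/predU1P => [-> | ak].
  rewrite sumelements_gf_first sumn_gf subn1 big_nat1 exprS.
  by rewrite !mulrA.
rewrite sumelements_gfS ?IHk //= (big_nat_recr k.+1) ?(ltnW ak) //=.
by rewrite exprS !mulrA.
Qed.

End Series.

(** * Geometric sums and the closed formula *)

Lemma q_neq1 : q != 1.
Proof.
rewrite /q -tofrac1 tofrac_eq; apply/eqP.
move=> /(congr1 (fun p : {poly rat} => size p)).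
by rewrite size_polyX size_poly1.
Qed.

Lemma sum_geometric (F : fieldType) (t : F) j : t != 1 ->
  \sum_(1 <= c < j.+1) t ^+ c = t * ((1 - t ^+ j) / (1 - t)).
Proof.
move=> t1; have u : 1 - t != 0 by rewrite subr_eq0 eq_sym.
rewrite -opprB subrX1 -mulNr opprB mulrAC divff // mul1r big_add1 /= big_mkord.
by rewrite big_distrr; apply: eq_bigr => i _; rewrite exprS.
Qed.

(* Over an abstract field: with the concrete [Qq], unification unfolds the
   construction of fractions and diverges. *)
Lemma set_partitions_gf (F : fieldType) (t : F) k a :
  t != 1 -> (0 < a <= k)%N ->
  Fps (fun n => if (k <= n)%N
                then \sum_(P in set_partitions n k)
                       t ^+ sumelements a (canonical_word P)
                else 0) =
    fpsX ^+ k * fpsC (t ^+ (a * (a - 1) %/ 2)) *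
    (\prod_(1 <= j < a) (1 / (1 - fpsX * fpsC (t * ((1 - t ^+ j) / (1 - t)))))) *
    (\prod_(a <= i < k.+1) (1 / (1 - i%:R * fpsX))).
Proof.
move=> t1 ak; transitivity (rgf_gf _ t (sumelements a) k).
  (* Below [k] the coefficient is 0 on both sides, as no word of length [n < k] uses [k] letters. *)
  apply/fpsP => n /=; case: leqP => [_ | /rgfs_lt->]; last by rewrite big_nil.
  exact: (big_set_partitions _ (fun w => t ^+ sumelements a w)).
rewrite sumelements_gf //; congr (_ * _ * _).
by apply: eq_bigr => j _; rewrite sum_geometric.
Qed.

Theorem theorem1 (k a : nat) (hk : (1 <= k)%N) (ha : (1 <= a <= k)%N) :
  P_gf k a =
    fpsX ^+ k * fpsC (q ^+ (a * (a - 1) %/ 2)) *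
    (\prod_(1 <= j < a) (1 / (1 - fpsX * fpsC (q * ((1 - q ^+ j) / (1 - q)))))) *
    (\prod_(a <= i < k.+1) (1 / (1 - i%:R * fpsX))).
Proof. exact: (set_partitions_gf _ _ _ _ q_neq1 ha). Qed.
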